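(* For $v\in\mathcal{V}$ put $$J[v]:=\int_P\{v'_+(a)(a-H[X_k])-v(a)\}\,\mathbb{Q}(da\times dk)+\int_N\{v'_-(a)(a-H[X_k])-v(a)\}\,\mathbb{Q}(da\times dk),$$ where $P:=\{(a,k)\in\mathcal{T}:a\ge H[X_k]\}$ and $N:=\{(a,k)\in\mathcal{T}:a<H[X_k]\}$, and for $t\in[0,\infty]$ let $\phi_t(\cdot)=(\cdot-t)_+\in\mathcal{V}$. Let $$\tau^*:=\arg\max_{t\in[0,\infty]}J[\phi_t].$$ Then $$\max_{v\in\mathcal{V}}J[v]=J[\phi_{\tau^*}].$$
   Context: Setting. $\mathbb{R}_+=[0,\infty)$, $\overline{\mathbb{R}}_+=[0,\infty]$, $(x-\infty)_+=0$. $K$ is a Polish space with its Borel $\sigma$-algebra. For each $k\in K$, $X_k$ is a nonnegative random variable (loss) with distribution function $F_k$ that is strictly increasing and continuous on its support, with possibly a jump at $0$; $\overline{F}_k=1-F_k$. $\tilde{\mathcal{T}}\subset(0,1)\times K$ is a measurable set whose projection onto $K$ is all of $K$, with $\alpha<1-F_k(0)$ for all $(\alpha,k)\in\tilde{\mathcal{T}}$, and $\mathrm{VaR}_\alpha(X_k)=\overline{F}_k^{-1}(\alpha)$. The (injective) map $\iota(\alpha,k)=(\mathrm{VaR}_\alpha(X_k),k)$ from $\tilde{\mathcal{T}}$ to $\mathbb{R}_+\times K$ is assumed measurable; $\mathcal{T}:=\iota(\tilde{\mathcal{T}})$ is the (measurable) set of types $(a,k)$. $\tilde{\mathbb{Q}}$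 is a probability measure on $\tilde{\mathcal{T}}$ and $\mathbb{Q}=\tilde{\mathbb{Q}}\circ\iota^{-1}$ is its image on $\mathbb{R}_+\times K$, so $\mathbb{Q}$ is concentrated on $\mathcal{T}$. $H:\mathcal{X}\to\mathbb{R}$ is a cost functional on a domain $\mathcal{X}$ of random variables containing all $X_k$; $H$ is monotone, convex, comonotonic additive, satisfies $H[X]\ge 0$ for nonnegative $X$ with $H[X]=0$ only if $X=0$ a.s., and $H[1]=1+\theta>1$. $\mathcal{V}$ is the collection of all increasing (non-decreasing), convex, 1-Lipschitz functions on $\mathbb{R}_+$ that vanish at $0$. $v'_\pm$ denote one-sided derivatives, with the convention $v'_-(0)=0$. Throughout, integrands are implicitly assumed measurable and integrable so that the profit functionals are well-defined. ($\tau^*=\arg\max$ means that $\tau^*$ is a point at which the maximum is attained.) *)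

(* Defs.v *)
From HB Require Import structures.
From mathcomp Require Import all_boot all_order all_algebra.
From mathcomp Require Import all_classical all_reals all_analysis.
Set Implicit Arguments.
Unset Strict Implicit.
Unset Printing Implicit Defensive.
Import Order.TTheory GRing.Theory Num.Theory.
Import numFieldNormedType.Exports.
Local Open Scope classical_set_scope.
Local Open Scope ring_scope.

Definition is_argmax {R : realType} {T : Type} (A : set T) (f : T -> R)
    (x : T) : Prop :=
  A x /\ forall y, A y -> f y <= f x.

(* [R] is only the type in which the metric takes its values. *)
Definition polish_space (R : realType) (K : topologicalType) : Prop :=
  (exists dist : K -> K -> R,
    [/\ forall x y, dist x y = 0 <-> x = y,
        forall x y, dist x y = dist y x,
        forall x y z, dist x z <= dist x y + dist y z,
        forall x (A : set K), nbhs x A <->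
          exists2 e : R, 0 < e & [set y | dist x y < e] `<=` A
      & forall u : nat -> K,
          (forall e : R, 0 < e -> exists N : nat, forall m n : nat,
             (N <= m)%N -> (N <= n)%N -> dist (u m) (u n) < e) ->
          exists l : K, u @ \oo --> l]) /\
  (exists2 D : set K, countable D & dense D).

(* [K] with its Borel sigma-algebra *)
Notation borel K := (g_sigma_algebraType (@open K)).

Section loss_and_cost.
Context d {Omega : measurableType d} {R : realType} {Pr : probability Omega R}.
Implicit Types X Y : {RV Pr >-> R}.

Definition ae_le X Y : Prop := {ae Pr, forall w, X w <= Y w}.

Definition ae_nonneg X : Prop := {ae Pr, forall w, 0 <= X w}.

(* topological support of the law of X *)
Definition law_support X : set R :=
  [set x | forall e : R, 0 < e -> (0 < distribution Pr X (ball x e))%E].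

(* The distribution function increases strictly on the support of the law and
   is continuous there, except possibly at 0. *)
Definition regular_loss X : Prop :=
  [/\ ae_nonneg X,
      forall x y, law_support X x -> law_support X y -> x < y ->
        (cdf X x < cdf X y)%E
    & forall x, law_support X x -> x != 0 -> {for x, continuous (cdf X)}].

(* Generalized inverse at alpha of the survival function [ccdf X] = 1 - F; for
   a regular loss and 0 < alpha < ccdf X 0 it is the unique x with
   ccdf X x = alpha. *)
Definition VaR (alpha : R) X : R := inf [set x | (ccdf X x <= alpha%:E)%E].

Definition comonotonic X Y : Prop :=
  exists2 A : set Omega, measurable A /\ Pr A = 1%E &
    forall w w', A w -> A w' -> 0 <= (X w - X w') * (Y w - Y w').

(* [dom] is the domain of the functional; nothing is required of [H] outside
   it. The domain is not assumed to be closed under sums or convex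
   combinations, so the corresponding properties are restricted to those that
   belong to it. *)
Record cost_functional (dom : set {RV Pr >-> R}) (H : {RV Pr >-> R} -> R)
    (theta : R) : Prop := CostFunctional {
  cost_monotone : forall X Y, dom X -> dom Y -> ae_le X Y -> H X <= H Y;
  cost_convex : forall X Y Z (t : R), dom X -> dom Y -> dom Z -> 0 <= t <= 1 ->
    (forall w, Z w = t * X w + (1 - t) * Y w) ->
    H Z <= t * H X + (1 - t) * H Y;
  cost_comonotonic : forall X Y Z, dom X -> dom Y -> dom Z ->
    comonotonic X Y -> (forall w, Z w = X w + Y w) -> H Z = H X + H Y;
  cost_ge0 : forall X, dom X -> ae_nonneg X -> 0 <= H X;
  cost_eq0 : forall X, dom X -> ae_nonneg X -> H X = 0 ->
    {ae Pr, forall w, X w = 0};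
  cost_dom1 : dom (cst 1);
  cost_loading_gt0 : 0 < theta;
  cost_1 : H (cst 1) = 1 + theta
}.

End loss_and_cost.

Definition type_map {d} {Omega : measurableType d} {R : realType}
    {Pr : probability Omega R} {K : ptopologicalType}
    (X : K -> {RV Pr >-> R}) (z : R * borel K) : R * borel K :=
  (VaR z.1 (X z.2), z.2).

Section contracts.
Context {R : realType}.

(* Functions on R_+ are represented by functions on R that are constrained only
   on [0, +oo[; the one-sided derivatives below at a point of [0, +oo[ do not
   depend on the values elsewhere. *)
Definition contracts : set (R -> R) :=
  [set v | [/\ v 0 = 0,
      forall x y, 0 <= x -> x <= y -> v x <= v y,
      @convex_function R R^o `[0, +oo[ v
    & 1.-lipschitz_(`[0, +oo[) v]].

Definition rderiv (v : R -> R) (a : R) : R :=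
  lim ((v (a + h) - v a) / h @[h --> 0^'+]).

Definition lderiv (v : R -> R) (a : R) : R :=
  if a == 0 then 0 else lim ((v (a + h) - v a) / h @[h --> 0^'-]).

(* (x - t)_+, which is 0 for t = +oo *)
Definition phi (t : \bar R) : R -> R :=
  fun x => fine (Order.max (x%:E - t)%E 0%E).

End contracts.

Section profit.
Context {R : realType} {K : ptopologicalType}.
Variables (h : K -> R) (T : set (R * borel K)).

Definition typesP : set (R * borel K) := [set z | T z /\ h z.2 <= z.1].
Definition typesN : set (R * borel K) := [set z | T z /\ z.1 < h z.2].

Definition profitP (v : R -> R) (z : R * borel K) : R :=
  rderiv v z.1 * (z.1 - h z.2) - v z.1.
Definition profitN (v : R -> R) (z : R * borel K) : R :=
  lderiv v z.1 * (z.1 - h z.2) - v z.1.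

Variable Q : probability (R * borel K)%type R.

Definition J (v : R -> R) : R :=
  \int[Q]_(z in typesP) profitP v z + \int[Q]_(z in typesN) profitN v z.

End profit.

(* Main.v *)
Require Import Defs.
From HB Require Import structures.
From mathcomp Require Import all_boot all_order all_algebra.
From mathcomp Require Import all_classical all_reals all_analysis.
From mathcomp Require Import unstable measurable_realfun ring lra zify.
Set Implicit Arguments.
Unset Strict Implicit.
Unset Printing Implicit Defensive.
Import Order.TTheory GRing.Theory Num.Theory.
Import numFieldNormedType.Exports.
Local Open Scope classical_set_scope.
Local Open Scope ring_scope.

(* A contract v is a mixture of layers: if t_c is the generalized inverse of
   its right derivative, v is the integral of phi_{t_c} over c in [0, 1], and
   so J[v] is an average of values J[phi_t]. To avoid Fubini, the levels c
   are restricted to 1/n, ..., n/n. By rounding down, the average v_n of the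
   corresponding layers satisfies v_n <= v, and its one-sided derivatives are
   at most those of v, with right derivative at least v'_+ - 1/n. On N, where
   a - h < 0, v_n hence earns at least as much as v; on P it earns at least
   as much up to a / n. As a need not be integrable, n tends to infinity by
   monotone convergence, the profits on P being bounded below by - h. *)

(** * One-sided derivatives of a contract *)

Section contract_derivatives.
Variables (R : realType) (v : R -> R).
Hypothesis cv : contracts v.
Implicit Types a c x y z : R.

(** Convexity with denominators cleared, so that slope comparisons become polynomial
    inequalities. *)
Lemma contract_chord x y z : 0 <= x -> x <= y -> y <= z ->
  (z - x) * v y <= (z - y) * v x + (y - x) * v z.
Proof.
move=> x0 xy yz.
have [xz|xz] := eqVneq x z.
  by have -> : y = x; [apply/le_anti; rewrite xy xz yz|rewrite -xz; lra].
have zx : 0 < z - x by rewrite subr_gt0 lt_neqAle xz (le_trans xy).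
have t0 : 0 <= (z - y) / (z - x) by rewrite divr_ge0 ?(ltW zx)// subr_ge0.
have t1 : (z - y) / (z - x) <= 1 by rewrite ler_pdivrMr// mul1r; lra.
have zI : z \in (`[0, +oo[%classic : set R).
  by rewrite inE /= in_itv /= andbT (le_trans x0)// (le_trans xy).
have xI : x \in (`[0, +oo[%classic : set R) by rewrite inE /= in_itv /= andbT.
have [_ _ vc _] := cv.
have := vc (Itv01 t0 t1) _ _ xI zI; rewrite convRE /= /onem.
set w := conv _ _ _; have -> : w = y.
  transitivity ((z - y) / (z - x) * x + (1 - (z - y) / (z - x)) * z) => //.
  by field; rewrite gt_eqF.
rewrite -(ler_pM2l zx) => /le_trans; apply.
rewrite le_eqVlt; apply/orP; left; apply/eqP; field.
by rewrite gt_eqF.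
Qed.

Lemma contract_ge0 x : 0 <= x -> 0 <= v x.
Proof. by move=> x0; have [v0 vm _ _] := cv; rewrite -v0 vm. Qed.

Lemma contract_incr_ge0 x y : 0 <= x -> x <= y -> 0 <= v y - v x.
Proof. by move=> x0 xy; have [_ vm _ _] := cv; rewrite subr_ge0 vm. Qed.

Lemma contract_incr_le x y : 0 <= x -> x <= y -> v y - v x <= y - x.
Proof.
move=> x0 xy; have [_ _ _ /(_ (y, x))] := cv.
rewrite /= !in_itv /= !andbT x0 (le_trans x0 xy) mul1r => /(_ (conj isT isT)).
by rewrite !ger0_norm ?contract_incr_ge0 ?subr_ge0.
Qed.

Lemma rquotient_homo a : 0 <= a ->
  {in [pred h : R | 0 < h] &,
    {homo (fun h => (v (a + h) - v a) / h) : x y / x <= y}}.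
Proof.
move=> a0 x y /[!inE] x0 y0 xy.
rewrite ler_pdivrMr// mulrAC ler_pdivlMr//.
have := @contract_chord a (a + x) (a + y) a0.
rewrite lerDl lerD2l => /(_ (ltW x0) xy).
nra.
Qed.

Lemma rquotient_cvg a : 0 <= a ->
  cvg ((v (a + h) - v a) / h @[h --> 0^'+]).
Proof.
move=> a0; apply: nondecreasing_at_right_is_cvgr; near=> e.
  move=> x y; rewrite !in_itv /= => /andP[x0 _] /andP[y0 _].
  exact: rquotient_homo.
exists 0; move=> + [h /= + <-]; rewrite in_itv /= => _ /andP[h0 _].
by rewrite divr_ge0 ?(ltW h0)// contract_incr_ge0// lerDl ltW.
Unshelve. all: by end_near. Qed.

(** Forward quotients decrease to the right derivative as the step shrinks, so each of them
    dominates it. *)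
Lemma rderiv_le a y : 0 <= a -> a < y ->
  rderiv v a * (y - a) <= v y - v a.
Proof.
move=> a0 ay; have ya : 0 < y - a by rewrite subr_gt0.
rewrite -ler_pdivlMr//; apply: limr_le; first exact: rquotient_cvg.
near=> h; have h0 : 0 < h by near: h; exact: nbhs_right_gt.
have hy : h < y - a by near: h; exact: nbhs_right_lt.
have := rquotient_homo a0 h0 ya (ltW hy).
by rewrite subrKC.
Unshelve. all: by end_near. Qed.

Lemma rderiv_ge a c : 0 <= a ->
  (forall y, a < y -> c * (y - a) <= v y - v a) -> c <= rderiv v a.
Proof.
move=> a0 H; apply: limr_ge; first exact: rquotient_cvg.
near=> h; have h0 : 0 < h by near: h; exact: nbhs_right_gt.
rewrite ler_pdivlMr//; have := H (a + h); rewrite ltrDl => /(_ h0).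
by rewrite addrAC subrr add0r.
Unshelve. all: by end_near. Qed.

Lemma rderiv_bounds a : 0 <= a -> 0 <= rderiv v a <= 1.
Proof.
move=> a0; apply/andP; split.
  by apply: rderiv_ge => // y ay; rewrite mul0r contract_incr_ge0// ltW.
have := @rderiv_le a (a + 1) a0; rewrite ltrDl ltr01 => /(_ isT).
have := @contract_incr_le a (a + 1) a0; rewrite lerDl ler01 => /(_ isT).
lra.
Qed.

(** By the chord inequality, the slope from [x] to [a] is a lower bound of all forward slopes at
    [a], hence of their limit. *)
Lemma incr_le_rderiv x a : 0 <= x -> x <= a ->
  v a - v x <= rderiv v a * (a - x).
Proof.
move=> x0; rewrite le_eqVlt => /predU1P[<-|xa]; first by rewrite !subrr mulr0.
have ax : 0 < a - x by rewrite subr_gt0.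
have a0 := le_trans x0 (ltW xa).
rewrite -ler_pdivrMr//; apply: rderiv_ge => // y ay.
rewrite mulrAC ler_pdivrMr//.
have := contract_chord x0 (ltW xa) (ltW ay); nra.
Qed.

Lemma rderiv_nd x y : 0 <= x -> x <= y -> rderiv v x <= rderiv v y.
Proof.
move=> x0; rewrite le_eqVlt => /predU1P[<-//|xy].
have yx : 0 < y - x by rewrite subr_gt0.
rewrite -(ler_pM2r yx); apply: le_trans (rderiv_le x0 xy) _.
exact: incr_le_rderiv (ltW xy).
Qed.

(* In [c (y - b) <= v y - v b <= v y - v a] let [b] decrease to [a]. *)
Lemma rderiv_right_cont a c : 0 <= a -> 0 <= c ->
  (forall b, a < b -> c <= rderiv v b) -> c <= rderiv v a.
Proof.
move=> a0 c0 H; apply: rderiv_ge => // y ay.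
apply/ler_addgt0Pr => e e0.
(* The [+ 1] avoids dividing by 0 when [c = 0]; the minimum below gives both [c * (b - a) <= e] and
   [b < y]. *)
have ec : 0 < e / (c + 1) by rewrite divr_gt0// ltr_wpDl.
pose b := a + Num.min (e / (c + 1)) ((y - a) / 2).
have ya2 : 0 < (y - a) / 2 by rewrite divr_gt0// subr_gt0.
have ab : a < b by rewrite ltrDl lt_min ec ya2.
have by' : b < y.
  by rewrite /b -ltrBrDl gt_min; apply/orP; right; lra.
have be : b <= a + e / (c + 1) by rewrite lerD2l ge_min lexx.
have cb : c * (b - a) <= e.
  apply: (@le_trans _ _ (c * (e / (c + 1)))).
    by rewrite ler_wpM2l// lerBlDl.
  rewrite mulrCA ler_piMr ?(ltW e0)// ler_pdivrMr; lra.
have b0 := le_trans a0 (ltW ab).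
have := rderiv_le b0 by'.
have := contract_incr_ge0 a0 (ltW ab).
have : c * (y - b) <= rderiv v b * (y - b).
  by rewrite ler_wpM2r ?subr_ge0 ?(ltW by')// H.
nra.
Qed.

(** Backward quotients increase to the left derivative as the negative step tends to 0; the step
    [x - a] gives the claim. *)
Lemma lderiv_ge x a : 0 <= x -> x < a -> v a - v x <= lderiv v a * (a - x).
Proof.
move=> x0 xa; have ax : 0 < a - x by rewrite subr_gt0.
have a0 : 0 < a by exact: le_lt_trans xa.
rewrite /lderiv gt_eqF// -ler_pdivrMr//.
have mono h k : - a <= h -> h <= k -> k < 0 ->
    (v (a + h) - v a) / h <= (v (a + k) - v a) / k.
  move=> ah hk k0; have h0 := le_lt_trans hk k0.
  rewrite -[X in X <= _]mulrNN -invrN -[X in _ <= X]mulrNN -invrN.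
  rewrite ler_pdivrMr ?oppr_gt0// mulrAC ler_pdivlMr ?oppr_gt0//.
  have := @contract_chord (a + h) (a + k) a.
  rewrite lerD2l -lerBlDl sub0r ah hk gerDl (ltW k0) => /(_ isT isT isT).
  nra.
apply: limr_ge.
  apply: nondecreasing_at_left_is_cvgr; near=> e; last first.
    (* The Lipschitz condition bounds the quotients by 1, once [- a < e] keeps [a + h]
       nonnegative. *)
    exists 1; move=> + [h /= + <-]; rewrite in_itv /= => _ /andP[eh h0].
    rewrite -[X in X <= _]mulrNN -invrN ler_pdivrMr ?oppr_gt0//.
    have := @contract_incr_le (a + h) a; rewrite gerDl (ltW h0).
    have ae : - a < e by near: e; apply: nbhs_left_gt; rewrite oppr_lt0.
    have : 0 <= a + h by lra.
    by move=> -> /(_ isT isT); lra.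
  move=> h k; rewrite !in_itv /= => /andP[eh h0] /andP[ek k0] hk.
  apply: mono => //.
  have ae : - a < e by near: e; apply: nbhs_left_gt; rewrite oppr_lt0.
  by rewrite ltW// (lt_trans ae).
near=> k; have k0 : k < 0 by near: k; exact: nbhs_left_lt.
have xk : x - a < k by near: k; apply: nbhs_left_gt; lra.
have := @mono (x - a) k; rewrite subrKC => /(_ _ (ltW xk) k0) H.
rewrite -[X in X <= _]mulrNN -invrN !opprB; apply: H; lra.
Unshelve. all: by end_near. Qed.

Lemma lderiv_ge0 a : 0 <= a -> 0 <= lderiv v a.
Proof.
rewrite le_eqVlt => /predU1P[<-|a0]; first by rewrite /lderiv eqxx.
have := lderiv_ge (lexx 0) a0; have [-> _ _ _] := cv.
rewrite !subr0 => H.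
by rewrite -(pmulr_lge0 _ a0) (le_trans _ H)// contract_ge0// ltW.
Qed.

End contract_derivatives.

(** * The layers [phi t] and their derivatives *)

Section layers.
Variable R : realType.
Implicit Types (a : R) (t : \bar R).

Lemma phi_fin (r : R) : phi r%:E = (fun x => Num.max (x - r) 0).
Proof. by apply/funext => x; rewrite /phi -EFinB -EFin_max. Qed.

Lemma phi_pinfty : phi +oo%E = (fun=> 0) :> (R -> R).
Proof. by apply/funext => x; rewrite /phi /= maxNye. Qed.

Lemma contracts_phi t : (0 <= t)%E -> contracts (@phi R t).
Proof.
case: t => [r| |]//=; last first.
  move=> _; rewrite phi_pinfty; split => //.
  - by move=> t x y _ _; rewrite convRE !mulr0 addr0.
  - by move=> [x y] _ /=; rewrite subrr normr0 mul1r.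
rewrite lee_fin => r0; rewrite phi_fin; split.
- by apply/max_idPr; rewrite sub0r oppr_le0.
- by move=> x y _ xy; rewrite ge_max !le_max lexx lerD2r xy orbT.
- move=> t x y _ _; rewrite [leRHS]convRE /=.
  have -> : conv t x y = t%:num * x + onem t%:num * y :> R by [].
  have t0 : 0 <= t%:num by [].
  have t1 : 0 <= onem t%:num by rewrite onem_ge0.
  rewrite ge_max; apply/andP; split; last first.
    by rewrite addr_ge0// mulr_ge0// le_max lexx orbT.
  apply: (@le_trans _ _ (t%:num * (x - r) + onem t%:num * (y - r))).
    by rewrite /onem le_eqVlt; apply/orP; left; apply/eqP; ring.
  by rewrite lerD// ler_wpM2l// le_max lexx.
- move=> [x y] _ /=; rewrite mul1r.
  rewrite ler_norml !maxEle.
  case: ifPn; case: ifPn; rewrite -?ltNge => ? ?;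
    rewrite ler_normr lerNl ler_normr; apply/andP; split; apply/orP; lra.
Qed.

(** At the kink [a = t] the right derivative is 1 and the left one 0: hence [<=] here and [<] in
    [lderiv_phi]. *)
Lemma rderiv_phi t a : (0 <= t)%E -> rderiv (phi t) a = (t <= a%:E)%E%:R.
Proof.
case: t => [r| |]//=.
  rewrite lee_fin => r0; rewrite phi_fin /rderiv lee_fin.
  apply: lim_near_cst => //; have [ra|ar] := leP r a.
    near=> h; have h0 : 0 < h by near: h; exact: nbhs_right_gt.
    rewrite /= !max_l ?subr_ge0//; last by lra.
    by field; rewrite gt_eqF.
  near=> h; have h0 : 0 < h by near: h; exact: nbhs_right_gt.
  have hr : h < r - a by near: h; apply: nbhs_right_lt; lra.
  by rewrite !max_r ?subrr ?mul0r//; lra.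
by move=> _; rewrite phi_pinfty /rderiv; apply: lim_near_cst => //; near=> h;
  rewrite subrr mul0r.
Unshelve. all: by end_near. Qed.

Lemma lderiv_phi t a : (0 <= t)%E -> 0 <= a ->
  lderiv (phi t) a = (t < a%:E)%E%:R.
Proof.
move=> t0; rewrite le_eqVlt /lderiv => /predU1P[<-|a0].
  by rewrite eqxx ltNge t0.
rewrite gt_eqF//; case: t t0 => [r| |]//=.
  rewrite lee_fin => r0; rewrite phi_fin lte_fin.
  apply: lim_near_cst => //; have [ra|ar] := ltP r a.
    near=> h; have h0 : h < 0 by near: h; exact: nbhs_left_lt.
    have hr : r - a < h by near: h; apply: nbhs_left_gt; lra.
    rewrite /= !max_l; [|lra|lra].
    by field; rewrite lt_eqF.
  near=> h; have h0 : h < 0 by near: h; exact: nbhs_left_lt.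
  by rewrite !max_r ?subrr ?mul0r//; lra.
by move=> _; rewrite phi_pinfty; apply: lim_near_cst => //; near=> h;
  rewrite subrr mul0r.
Unshelve. all: by end_near. Qed.

End layers.

(* Summing over a uniform partition of [0, a] in m steps, the error telescopes
   to (a / m) (p a - p 0). *)
Lemma increments_le (R : realType) (f g p : R -> R) (a : R) : 0 <= a ->
  f 0 = g 0 ->
  (forall x y, 0 <= x -> x <= y -> p x * (y - x) <= f y - f x) ->
  (forall x y, 0 <= x -> x <= y -> g y - g x <= p y * (y - x)) ->
  g a <= f a.
Proof.
move=> a0 fg0 fp gp.
suff H m : g a <= f a + a / m.+1%:R * (p a - p 0).
  apply/ler_addgt0Pr => e e0.
  (* Chosen so that [a * |p a - p 0| / e < m.+1], which makes the error at most [e]. *)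
  pose m := Num.truncn (a * `|p a - p 0| / e).
  apply: (le_trans (H m)); rewrite lerD2l.
  apply: (@le_trans _ _ (a / m.+1%:R * `|p a - p 0|)).
    by rewrite ler_wpM2l ?divr_ge0// ler_norm.
  have : a * `|p a - p 0| / e < m.+1%:R by exact: truncnS_gt.
  by rewrite ltr_pdivrMr// mulrAC ler_pdivrMr// [e * _]mulrC => /ltW.
set d := a / m.+1%:R; have d0 : 0 <= d by rewrite divr_ge0.
have : forall k : nat, g (k%:R * d) <= f (k%:R * d) + d * (p (k%:R * d) - p 0).
  elim=> [|k IH]; first by rewrite !mul0r subrr mulr0 addr0 fg0.
  have k0 : 0 <= k%:R * d by rewrite mulr_ge0.
  have k1 : k%:R * d <= k.+1%:R * d by rewrite ler_wpM2r// ler_nat.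
  have kd : k.+1%:R * d - k%:R * d = d by rewrite -mulrBl -natrB// subSnn mul1r.
  have := fp _ _ k0 k1; have := gp _ _ k0 k1; rewrite kd; nra.
by move=> /(_ m.+1); rewrite /d mulrCA divff ?mulr1.
Qed.

(** * Rounding down to a uniform grid *)

Section quantization.
Variable R : realType.

Lemma sum_lt_min (n m : nat) :
  \sum_(i < n) (i < m)%N%:R = (minn n m)%:R :> R.
Proof.
elim: n => [|n IH]; first by rewrite big_ord0 min0n.
rewrite big_ord_recr /= IH -natrD; congr (_%:R).
by case: ltnP => nm; rewrite /minn; case: ltnP; case: ltnP; lia.
Qed.

(** [q] is [y] rounded down to a multiple of [1 / n.+1] and capped at 1: the grid levels up to [y]
    number the minimum of [n.+1] and the integer part of [n.+1 * y]. *)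
Lemma quantize_bounds (n : nat) (y : R) : 0 <= y ->
  let q := n.+1%:R^-1 * \sum_(i < n.+1) (i.+1%:R / n.+1%:R <= y)%R%:R in
  q <= y /\ (y <= 1 -> y <= q + n.+1%:R^-1).
Proof.
move=> y0 q; pose m := Num.truncn (n.+1%:R * y).
have ny0 : 0 <= n.+1%:R * y by rewrite mulr_ge0.
have qE : q = (minn n.+1 m)%:R / n.+1%:R.
  rewrite /q mulrC -sum_lt_min; congr (_ / _); apply: eq_bigr => i _.
  by rewrite /m truncn_gt_nat ler_pdivrMr// [y * _]mulrC.
rewrite qE; split.
  rewrite ler_pdivrMr// [y * _]mulrC.
  by apply: (@le_trans _ _ m%:R); rewrite ?ler_nat ?geq_minr// /m truncn_le.
move=> y1; rewrite -[X in _ + X]mul1r -mulrDl ler_pdivlMr// mulrC.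
case: (leqP n.+1 m) => [nm|mn].
  by apply: ler_wpDr => //; rewrite ler_piMr.
by rewrite natr1 ltW// truncnS_gt.
Qed.

End quantization.

(** * Approximating a contract by means of layers *)

Section layer_cake.
Variables (R : realType) (v : R -> R).
Hypothesis cv : contracts v.
Implicit Types a c x y : R.

(* generalized inverse of [rderiv v]; +oo if [rderiv v] stays below [c] *)
Definition level c : \bar R :=
  ereal_inf [set x%:E | x in [set x | 0 <= x /\ c <= rderiv v x]].

Lemma level_ge0 c : (0 <= level c)%E.
Proof. by apply: le_ereal_inf_tmp => _ [x [x0 _] <-]; rewrite lee_fin. Qed.

(** The Galois connection of a generalized inverse. Right continuity of [rderiv v] handles the case
    where the infimum equals [a]. *)
Lemma level_le a c : 0 <= a -> 0 <= c ->
  (level c <= a%:E)%E = (c <= rderiv v a).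
Proof.
move=> a0 c0; apply/idP/idP => [ca|ca]; last first.
  by apply: ereal_inf_lbound; exists a.
apply: rderiv_right_cont => // b ab.
have /ereal_inf_ltP[_ [x [x0 cx] <-]] : (level c < b%:E)%E.
  by rewrite (le_lt_trans ca)// lte_fin.
by rewrite lte_fin => xb; rewrite (le_trans cx)// rderiv_nd// ltW.
Qed.

(** Some [x < a] has right derivative at least [c], and the slope from [x] to [a] lies between this
    derivative and [lderiv v a]. *)
Lemma level_lt a c : (level c < a%:E)%E -> c <= lderiv v a.
Proof.
move=> /ereal_inf_ltP[_ [x [x0 cx] <-]]; rewrite lte_fin => xa.
have ax : 0 < a - x by rewrite subr_gt0.
rewrite (le_trans cx)// -(ler_pM2r ax).
exact: le_trans (rderiv_le cv x0 xa) (lderiv_ge cv x0 xa).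
Qed.

(** With [i.+1] the levels are [1 / n.+1, ..., 1]; leaving out level 0 makes the rounding go
    down. *)
Definition layer (n : nat) (i : 'I_n.+1) : \bar R :=
  level (i.+1%:R / n.+1%:R).

Lemma layer_ge0 n (i : 'I_n.+1) : (0 <= layer i)%E.
Proof. exact: level_ge0. Qed.

(* A Riemann sum for the integral of [f (level c)] over [c] in [0, 1]; for
   [f t = phi t a] this integral is [v a]. *)
Definition mean n (f : \bar R -> R) : R :=
  n.+1%:R^-1 * \sum_(i < n.+1) f (layer i).

Lemma ler_mean n f g : (forall t, (0 <= t)%E -> f t <= g t) ->
  mean n f <= mean n g.
Proof.
move=> fg; rewrite ler_wpM2l ?invr_ge0//; apply: ler_sum => i _.
exact/fg/layer_ge0.
Qed.

Lemma mean_cst n c : mean n (fun=> c) = c.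
Proof.
by rewrite /mean sumr_const card_ord -[c *+ _]mulr_natl mulrA mulVf ?mul1r.
Qed.

Lemma meanB n f g : mean n (fun t => f t - g t) = mean n f - mean n g.
Proof. by rewrite /mean sumrB mulrBr. Qed.

Lemma meanMr n f c : mean n (fun t => f t * c) = mean n f * c.
Proof. by rewrite /mean -mulr_suml mulrA. Qed.

(** By [level_le] the mean counts the grid levels up to [rderiv v a], so it is this derivative
    rounded down. *)
Lemma mean_rderiv n a : 0 <= a ->
  rderiv v a - n.+1%:R^-1 <= mean n (fun t => rderiv (phi t) a) <= rderiv v a.
Proof.
move=> a0; rewrite lerBlDr; set q := mean _ _.
have /andP[p0 p1] := rderiv_bounds cv a0.
have [H1 H2] := quantize_bounds n p0.
suff -> : q = n.+1%:R^-1 *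
    \sum_(i < n.+1) (i.+1%:R / n.+1%:R <= rderiv v a)%R%:R by rewrite H1 H2//.
rewrite /q /mean; congr (_ * _); apply: eq_bigr => i _.
by rewrite rderiv_phi ?layer_ge0// level_le.
Qed.

Lemma mean_lderiv n a : 0 <= a ->
  mean n (fun t => lderiv (phi t) a) <= lderiv v a.
Proof.
move=> a0; have [H _] := quantize_bounds n (lderiv_ge0 cv a0).
apply: le_trans H; rewrite ler_wpM2l ?invr_ge0//; apply: ler_sum => i _.
rewrite lderiv_phi ?layer_ge0// ler_nat.
by case: (boolP (_ < _)%E) => // /level_lt ->.
Qed.

(** [rderiv v] bounds the increments of [v] from below at the left end and, by [mean_rderiv], those
    of the mean from above at the right end. *)
Lemma mean_phi n a : 0 <= a -> mean n (fun t => phi t a) <= v a.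
Proof.
move=> a0.
apply: (@increments_le _ v (fun a => mean n (phi^~ a)) (rderiv v)) => //.
- have [-> _ _ _] := cv; rewrite -[LHS](mean_cst n); congr (_ * _).
  by apply: eq_bigr => i _; have [-> _ _ _] := contracts_phi (layer_ge0 i).
- move=> x y x0; rewrite le_eqVlt => /predU1P[<-|xy].
    by rewrite !subrr mulr0.
  exact: rderiv_le.
move=> x y x0 xy; have y0 := le_trans x0 xy; rewrite -meanB.
have /andP[_ H] := mean_rderiv n y0.
apply: le_trans (ler_wpM2r _ H); last by rewrite subr_ge0.
rewrite -meanMr; apply: ler_mean => t t0.
exact: (incr_le_rderiv (contracts_phi t0) x0 xy).
Qed.

(** * Pointwise comparison of profits *)

Section profits.
Variables (K : ptopologicalType) (h : K -> R).
Implicit Type z : R * borel K.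

(** As [phi t a <= rderiv (phi t) a * a], the profit is at least [- rderiv (phi t) a * h], and the
    derivative is at most 1. *)
Lemma profitP_phi_ge z t : 0 <= z.1 -> 0 <= h z.2 -> (0 <= t)%E ->
  - h z.2 <= profitP h (phi t) z.
Proof.
move=> a0 h0 t0; rewrite /profitP.
have := incr_le_rderiv (contracts_phi t0) (lexx 0) a0.
have /andP[] := rderiv_bounds (contracts_phi t0) a0.
have [-> _ _ _] := contracts_phi t0; nra.
Qed.

(** The error [1 / n.+1] in the derivative costs at most [(a - h) / n.+1]; the smaller value of the
    mean only helps. *)
Lemma profitP_le_mean n z : 0 <= h z.2 -> h z.2 <= z.1 ->
  profitP h v z <= mean n (fun t => profitP h (phi t) z) + z.1 / n.+1%:R.
Proof.
move=> h0 ha; have a0 := le_trans h0 ha.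
rewrite /profitP meanB meanMr.
have V := mean_phi n a0; have /andP[Q _] := mean_rderiv n a0.
have N0 : 0 <= n.+1%:R^-1 * h z.2 by rewrite mulr_ge0 ?invr_ge0.
have ah : 0 <= z.1 - h z.2 by rewrite subr_ge0.
have := ler_wpM2r ah Q.
by move: N0 V; set k := n.+1%:R^-1; lra.
Qed.

(** The negative factor [a - h] reverses [mean_lderiv], so there is no error term. *)
Lemma profitN_le_mean n z : 0 <= z.1 -> z.1 < h z.2 ->
  profitN h v z <= mean n (fun t => profitN h (phi t) z).
Proof.
move=> a0 ah; rewrite /profitN meanB meanMr.
have := mean_phi n a0; have := mean_lderiv n a0; nra.
Qed.

End profits.

End layer_cake.

(** * Integrals of means and passage to the limit *)

Section integrals.
Context d (T : measurableType d) (R : realType).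
Variables (mu : {measure set T -> \bar R}) (D : set T).
Hypothesis mD : measurable D.

Lemma integrable_sumr I (s : seq I) (f : I -> T -> R) :
  (forall i, mu.-integrable D (EFin \o f i)) ->
  mu.-integrable D (EFin \o (fun x => \sum_(i <- s) f i x)).
Proof.
move=> fi.
have := @integrable_sum _ _ _ mu _ mD _ s xpredT (fun i => EFin \o f i)
  (fun i _ => fi i).
by apply: eq_integrable => // x _ /=; rewrite sumEFin.
Qed.

Lemma Rintegral_sum I (s : seq I) (f : I -> T -> R) :
  (forall i, mu.-integrable D (EFin \o f i)) ->
  \int[mu]_(x in D) (\sum_(i <- s) f i x) =
  \sum_(i <- s) \int[mu]_(x in D) f i x.
Proof.
move=> fi; elim: s => [|i s IH].
  rewrite big_nil; under eq_Rintegral do rewrite big_nil.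
  by rewrite /Rintegral integral0.
rewrite big_cons -IH -RintegralD//; last exact: integrable_sumr.
by apply: eq_Rintegral => x _; rewrite big_cons.
Qed.

Lemma integrable_mean v n (f : \bar R -> T -> R) :
  (forall t, (0 <= t)%E -> mu.-integrable D (EFin \o f t)) ->
  mu.-integrable D (EFin \o (fun x => mean v n (f^~ x))).
Proof.
move=> fi.
have /(integrableZl mD n.+1%:R^-1) := integrable_sumr (index_enum 'I_n.+1)
  (fun i => fi _ (layer_ge0 v i)).
by apply: eq_integrable.
Qed.

Lemma Rintegral_mean v n (f : \bar R -> T -> R) :
  (forall t, (0 <= t)%E -> mu.-integrable D (EFin \o f t)) ->
  \int[mu]_(x in D) mean v n (f^~ x) =
  mean v n (fun t => \int[mu]_(x in D) f t x).
Proof.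
move=> fi; have fi' (i : 'I_n.+1) := fi _ (layer_ge0 v i).
by rewrite /mean RintegralZl ?Rintegral_sum//; exact: integrable_sumr.
Qed.

(* Monotone convergence applied to [max (f + g - u / n.+1) 0]; [u] is not
   assumed to be integrable. *)
Lemma Rintegral_le_approx (f g u : T -> R) (A : nat -> T -> R) (c : R) :
  mu.-integrable D (EFin \o f) -> mu.-integrable D (EFin \o g) ->
  measurable_fun D u -> (forall x, D x -> 0 <= u x) ->
  (forall x, D x -> - g x <= f x) ->
  (forall n, mu.-integrable D (EFin \o A n)) ->
  (forall n x, D x -> - g x <= A n x) ->
  (forall n x, D x -> f x <= A n x + u x / n.+1%:R) ->
  (forall n, \int[mu]_(x in D) A n x <= c) ->
  \int[mu]_(x in D) f x <= c.
Proof.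
move=> fi gi mu_ u0 gf Ai gA fA Ac.
pose b n x := Num.max (f x + g x - u x / n.+1%:R) 0.
have mf : measurable_fun D f.
  by apply/measurable_EFinP; exact: measurable_int fi.
have mg : measurable_fun D g.
  by apply/measurable_EFinP; exact: measurable_int gi.
have mb n : measurable_fun D (b n).
  apply: measurable_maxr => //; apply: measurable_funB.
    exact: measurable_funD.
  exact: measurable_funM.
have b_cvg x : D x -> (b n x)%:E @[n --> \oo] --> (f x + g x)%:E.
  move=> Dx; apply: cvg_EFin; first by near=> n.
  (* The limit takes the shape of [b n x] with [1 / n.+1] replaced by 0; the maximum is harmless
     since [- g x <= f x]. *)
  have -> : f x + g x = Num.max (f x + g x - u x * 0) 0.
    by rewrite mulr0 subr0 max_l// -lerBlDr sub0r gf.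
  have max_cont := @continuous_max R R id (fun=> 0) (f x + g x - u x * 0)
    (fun _ => id) (@cst_continuous _ _ _ _).
  suff : f x + g x - u x / n.+1%:R @[n --> \oo] --> f x + g x - u x * 0.
    by move=> /cvg_comp /(_ max_cont).
  apply: cvgB; first exact: cvg_cst.
  exact: (cvgM (cvg_cst _) cvg_harmonic).
have H : (\int[mu]_(x in D) (b n x)%:E)%E @[n --> \oo] -->
    (\int[mu]_(x in D) limn (fun n => (b n x)%:E))%E.
  apply: cvg_monotone_convergence => //.
  - by move=> n; apply/measurable_EFinP.
  - by move=> n x Dx; rewrite lee_fin /b le_max lexx orbT.
  - move=> x Dx n m nm; rewrite lee_fin /b ge_max !le_max lexx orbT andbT.
    by rewrite lerD2l lerN2 ler_wpM2l ?u0// lef_pV2 ?posrE// ler_nat ltnS nm.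
have E F : mu.-integrable D (EFin \o F) ->
    (\int[mu]_(x in D) (F x)%:E)%E = (\int[mu]_(x in D) F x)%:E.
  by move=> Fi; rewrite /Rintegral fineK// integrable_fin_num.
have : (\int[mu]_(x in D) limn (fun n => (b n x)%:E) <=
    (c + \int[mu]_(x in D) g x)%:E)%E.
  rewrite -(cvg_lim _ H)//; apply: lime_le.
    by apply/cvg_ex; eexists; exact: H.
  (* Pointwise [b n <= A n + g], by [fA] and [gA]. *)
  near=> n; apply: (@le_trans _ _ (\int[mu]_(x in D) (A n x + g x)%:E)%E).
    apply: ge0_le_integral => //.
    - by move=> x _; rewrite lee_fin /b le_max lexx orbT.
    - by apply/measurable_EFinP.
    - apply/measurable_EFinP; apply: measurable_funD => //.
      by apply/measurable_EFinP; exact: measurable_int (Ai n).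
    - move=> x Dx; rewrite lee_fin /b ge_max.
      rewrite -[X in _ && X]lerBlDr sub0r gA// andbT.
      by rewrite lerBlDr [leRHS]addrAC lerD2r fA.
  rewrite E ?RintegralD// ?lee_fin ?lerD2r//.
  exact: (integrableD mD (Ai n) gi).
(* The limit integrand is [f + g], and the finite integral of [g] cancels. *)
under eq_integral => x /[!inE] Dx do rewrite (cvg_lim _ (b_cvg x Dx))//.
rewrite E ?RintegralD// ?lee_fin ?lerD2r//.
exact: (integrableD mD fi gi).
Unshelve. all: by end_near. Qed.

End integrals.

(** * Nonnegativity of types and optimality of the best layer *)

Lemma VaR_ge0 d (Omega : measurableType d) (R : realType)
    (Pr : probability Omega R) (X : {RV Pr >-> R}) (alpha : R) :
  (alpha%:E < ccdf X 0)%E -> 0 <= VaR alpha X.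
Proof.
move=> a0; rewrite /VaR; set E := [set _ | _].
have [->|/set0P E0] := eqVneq E set0; first by rewrite inf0.
(* The survival function is nonincreasing and exceeds [alpha] at 0, so [E] has no negative
   element. *)
apply: lb_le_inf => // x /= Ex; rewrite leNgt; apply/negP => x0.
have := lt_le_trans a0 (le_trans (ccdf_nonincreasing X (ltW x0)) Ex).
by rewrite ltxx.
Qed.

Theorem theorem6p2 (R : realType)
  (K : ptopologicalType) (polishK : polish_space R K)
  (d : measure_display) (Omega : measurableType d) (Pr : probability Omega R)
  (X : K -> {RV Pr >-> R}) (regX : forall k, regular_loss (X k))
  (dom : set {RV Pr >-> R}) (H : {RV Pr >-> R} -> R) (theta : R)
  (costH : cost_functional dom H theta) (domX : forall k, dom (X k))
  (Tt : set (R * borel K)) (mTt : measurable Tt)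
  (Tt01 : forall z, Tt z -> 0 < z.1 < 1)
  (Tt_proj : snd @` Tt = [set: K])
  (Tt_lt : forall z, Tt z -> (z.1%:E < ccdf (X z.2) 0)%E)
  (m_map : measurable_fun Tt (type_map X))
  (mT : measurable (type_map X @` Tt))
  (Qt : probability (R * borel K)%type R) (QtT : Qt Tt = 1%E)
  (Q : probability (R * borel K)%type R)
  (QE : forall A, measurable A -> Q A = Qt (Tt `&` type_map X @^-1` A))
  (mH : measurable_fun (type_map X @` Tt) (fun z => H (X z.2)))
  (intP : forall v, contracts v ->
     Q.-integrable (typesP (H \o X) (type_map X @` Tt))
       (EFin \o profitP (H \o X) v))
  (intN : forall v, contracts v ->
     Q.-integrable (typesN (H \o X) (type_map X @` Tt))
       (EFin \o profitN (H \o X) v))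
  (tau : \bar R)
  (tauE : is_argmax [set t | (0 <= t)%E]
     (fun t => J (H \o X) (type_map X @` Tt) Q (phi t)) tau) :
  is_argmax contracts (J (H \o X) (type_map X @` Tt) Q) (phi tau).
Proof.
move: tauE intP intN mT mH; set h := H \o X; set T := _ @` Tt.
move=> [tau0 tau_max] intP intN mT mH.
split; first exact: contracts_phi.
move=> v cv.
have h0 k : 0 <= h k by apply: (cost_ge0 costH (domX k)); have [] := regX k.
have T0 z : T z -> 0 <= z.1.
  by move=> [w Tw <-] /=; apply: VaR_ge0; exact: Tt_lt.
have mfst : measurable_fun T (fst : R * borel K -> R).
  by apply: measurable_funTS; exact: measurable_fst.
have mP : measurable (typesP h T).
  have -> : typesP h T = T `&` (fun z => h z.2 <= z.1) @^-1` [set true].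
    by apply/seteqP; split=> z.
  exact: (measurable_fun_ler mH mfst).
have mN : measurable (typesN h T).
  have -> : typesN h T = T `&` (fun z => z.1 < h z.2) @^-1` [set true].
    by apply/seteqP; split=> z.
  exact: (measurable_fun_ltr mfst mH).
have iP t : (0 <= t)%E ->
    Q.-integrable (typesP h T) (EFin \o profitP h (phi t)).
  by move=> t0; exact/intP/contracts_phi.
have iN t : (0 <= t)%E ->
    Q.-integrable (typesN h T) (EFin \o profitN h (phi t)).
  by move=> t0; exact/intN/contracts_phi.
(* The layer [t = 0] earns [- h] on [typesP]. *)
have ih : Q.-integrable (typesP h T) (EFin \o (fun z => h z.2)).
  have := integrableN (iP 0%E (lexx _)); apply: eq_integrable => //.
  move=> z /[!inE] -[/T0 z0 _] /=; rewrite /profitP rderiv_phi// lee_fin z0.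
  rewrite phi_fin subr0 max_l//; by rewrite mul1r opprB subKr.
(* Only the integral over [typesP] needs a limit; the one over [typesN] moves into the bound [c]. *)
rewrite /J -lerBrDr.
apply: (@Rintegral_le_approx _ _ _ Q _ mP _ (fun z => h z.2) fst
  (fun n z => mean v n (fun t => profitP h (phi t) z))) => //.
- exact: intP.
- by apply: measurable_funTS; exact: measurable_fst.
- by move=> z [/T0].
- move=> z [/T0 z0 _]; rewrite /profitP.
  have := incr_le_rderiv cv (lexx 0) z0.
  have /andP[] := rderiv_bounds cv z0.
  have := h0 z.2; have [-> _ _ _] := cv; nra.
- by move=> n; exact: integrable_mean.
- move=> n z [/T0 z0 _]; rewrite -[leLHS](mean_cst v n).
  by apply: ler_mean => t t0; exact: profitP_phi_ge.
- by move=> n z [Tz hz]; exact: profitP_le_mean.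
(* For fixed [n] the left side is at most the mean of the values [J (phi t)]: by linearity on
   [typesP] and by [profitN_le_mean] on [typesN]. *)
move=> n; rewrite lerBrDr.
apply: (@le_trans _ _ (mean v n (fun t => J h T Q (phi t)))); last first.
  by rewrite -[leRHS](mean_cst v n); apply: ler_mean => t t0; exact: tau_max.
rewrite Rintegral_mean//.
have -> : mean v n (fun t => J h T Q (phi t)) =
    mean v n (fun t => \int[Q]_(z in typesP h T) profitP h (phi t) z) +
    mean v n (fun t => \int[Q]_(z in typesN h T) profitN h (phi t) z).
  by rewrite /mean -mulrDr -big_split.
rewrite lerD2l -Rintegral_mean//; apply: le_Rintegral => //.
- exact: intN.
- exact: integrable_mean.
by move=> z [Tz zh]; apply: profitN_le_mean => //; exact: T0.
Qed.
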